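(* Let $\Omega\subset\mathbb{R}^d$ be a bounded open convex set contained in the unit ball $\{x:|x|<1\}$, and let $U$ be a convex open subset of $\Omega$ with $0\in U$. Let $\{\sigma_i\}_{i\in\mathbb{N}}$ be a sequence of unit vectors dense in the sphere $\mathbb{S}^{d-1}$, for each $i$ let $x_i\in\partial U$ maximize $\sigma_i\cdot x$ over $x\in\bar U$, and for $n\in\mathbb{N}$ put $\Phi_n(x)=\max\{0,\max_{1\le i\le n}\sigma_i\cdot(x-x_i)\}$. Let $\Phi(x)=\operatorname{dist}(x,U)$, and for each $k\in\mathbb{N}$ let $N_k$ be such that $\sup_{x\in\Omega}|\Phi_n(x)-\Phi(x)|<\frac1k$ for all $n\ge N_k$. Let $\{a_k\}_{k\in\mathbb{N}}$ be a decreasing sequence of positive numbers satisfying $a_{k+1}\le\frac1k a_k$ for all $k$. Let $$\varphi(x)=\sup_k a_k\Phi_{N_k}(x),\qquad x\in\Omega.$$ Then $\varphi$ is nonnegative, convex, and locally affine a.e., with $\varphi(x)=0$ if and only if $x\in\bar U$ (for $x\in\Omega$).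
   Context: $\mathbb{N}=\{1,2,3,\dots\}$. A function $\varphi:\Omega\to\mathbb{R}$ is locally affine a.e. if, for Lebesgue-a.e. $x\in\Omega$, $\varphi$ is affine on some neighborhood of $x$. The functions $\Phi_n$ increase to $\Phi$, uniformly on $\Omega$, so that integers $N_k$ as described exist. *)

(* Defs.v *)
From HB Require Import structures.
From mathcomp Require Import all_boot all_order all_algebra.
From mathcomp Require Import all_classical all_reals all_analysis.

Set Implicit Arguments.
Unset Strict Implicit.
Unset Printing Implicit Defensive.

Import Order.TTheory GRing.Theory Num.Theory.
Import numFieldNormedType.Exports.

Local Open Scope classical_set_scope.
Local Open Scope ring_scope.

(* R^d is 'rV[R]_d.  The norm that the library puts on 'rV[R]_d is the sup norm,
   so the Euclidean norm is defined here; both induce the same topology, and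
   [open], [closure], [interior] and [nbhs] are the library's.
   Sequences indexed by {1, 2, 3, ...} are functions on nat whose value at 0 is
   never used. *)

Definition dotv (R : realType) (d : nat) (u v : 'rV[R]_d) : R :=
  \sum_i u ord0 i * v ord0 i.

Definition enorm (R : realType) (d : nat) (u : 'rV[R]_d) : R :=
  Num.sqrt (dotv u u).

Definition dist_set (R : realType) (d : nat) (U : set 'rV[R]_d)
    (y : 'rV[R]_d) : R :=
  inf [set enorm (y - u) | u in U].

Definition boundary (T : topologicalType) (A : set T) : set T :=
  closure A `\` interior A.

Definition closed_box (R : realType) (d : nat) (a b : 'rV[R]_d) :
    set 'rV[R]_d :=
  [set x | forall i, a ord0 i <= x ord0 i <= b ord0 i].

Definition box_volume (R : realType) (d : nat) (a b : 'rV[R]_d) : R :=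
  \prod_i (b ord0 i - a ord0 i).

(* The library has Lebesgue measure on R only; this is d-dimensional Lebesgue
   outer measure, as the infimum of the total volumes of countable covers by
   closed boxes. *)
Definition lebesgue_outer (R : realType) (d : nat) (A : set 'rV[R]_d) :
    \bar R :=
  ereal_inf [set s | exists a b : nat -> 'rV[R]_d,
    [/\ forall k i, a k ord0 i <= b k ord0 i,
        A `<=` \bigcup_k closed_box (a k) (b k) &
        s = (\sum_(0 <= k <oo) (box_volume (a k) (b k))%:E)%E]].

Definition lebesgue_null (R : realType) (d : nat) (A : set 'rV[R]_d) : Prop :=
  lebesgue_outer A = 0%E.

(* The values of f outside Omega are irrelevant: f stands for its restriction
   to Omega. *)
Definition locally_affine_at (R : realType) (d : nat) (Omega : set 'rV[R]_d)
    (f : 'rV[R]_d -> R) (x : 'rV[R]_d) : Prop :=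
  exists (l : {scalar 'rV[R]_d}) (c : R),
    \forall y \near x, Omega y -> f y = l y + c.

Definition locally_affine_ae (R : realType) (d : nat) (Omega : set 'rV[R]_d)
    (f : 'rV[R]_d -> R) : Prop :=
  lebesgue_null [set x | Omega x /\ ~ locally_affine_at Omega f x].

Definition Phi_ (R : realType) (d : nat) (sigma x_ : nat -> 'rV[R]_d) (n : nat)
    (y : 'rV[R]_d) : R :=
  \big[Num.max/0]_(1 <= i < n.+1) dotv (sigma i) (y - x_ i).

(* For y in Omega the values a_k * Phi_{N_k}(y), k >= 1, are bounded above under
   the hypotheses made where this is used, so [sup] is the actual supremum. *)
Definition varphi (R : realType) (d : nat) (sigma x_ : nat -> 'rV[R]_d)
    (a : nat -> R) (N : nat -> nat) (y : 'rV[R]_d) : R :=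
  sup [set a k * Phi_ sigma x_ (N k) y | k in [set k | (1 <= k)%N]].

(* Main.v *)
Require Import Defs.
From HB Require Import structures.
From mathcomp Require Import all_boot all_order all_algebra.
From mathcomp Require Import all_classical all_reals all_analysis.
From mathcomp Require Import ring lra.
Import Order.TTheory GRing.Theory Num.Theory.
Import numFieldNormedType.Exports.
Local Open Scope classical_set_scope.
Local Open Scope ring_scope.

(* Away from the closure of U, phi is locally a maximum of finitely many of the
   affine functions a_k * sigma_i.(y - x_i): one of them is positive at the
   given point, and a_k -> 0 while the Phi_(N_k) are bounded on Omega.  Such a
   maximum is affine near every point where no two distinct members of the family
   coincide.  The exceptional set is thus contained in countably many
   hyperplanes and the boundary of U.  Bounded pieces of both are null because
   they project to R^(d-1) by maps with Lipschitz inverse: for a hyperplane,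
   forget a coordinate; for the boundary of a convex neighbourhood of 0, project
   radially to the faces of a cube. *)

Set Implicit Arguments.
Unset Strict Implicit.
Unset Printing Implicit Defensive.

(** * Null sets through box covers, and their countable unions *)

Lemma box_volume_ge0 (R : realType) (d : nat) (a b : 'rV[R]_d) :
  (forall i, a ord0 i <= b ord0 i) -> 0 <= box_volume a b.
Proof. by move=> ab; apply: prodr_ge0 => i _; rewrite subr_ge0. Qed.

(** Both corners sit in one sequence of pairs, so that a family of covers comes from a single use of
    [choice]. *)
Definition box_cover (R : realType) (d : nat) (A : set 'rV[R]_d) (e : R)
    (ab : nat -> 'rV[R]_d * 'rV[R]_d) : Prop :=
  [/\ forall k i, (ab k).1 ord0 i <= (ab k).2 ord0 i,
      A `<=` \bigcup_k closed_box (ab k).1 (ab k).2 &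
      (\sum_(0 <= k <oo) (box_volume (ab k).1 (ab k).2)%:E <= e%:E)%E].

Lemma lebesgue_nullP (R : realType) (d : nat) (A : set 'rV[R]_d) :
  lebesgue_null A <-> forall e : R, 0 < e -> exists ab, box_cover A e ab.
Proof.
rewrite /lebesgue_null /lebesgue_outer; set S := [set _ | _].
have S0 : (0 <= ereal_inf S)%E.
  apply: le_ereal_inf_tmp => _ [a [b [ab _ ->]]].
  apply: nneseries_ge0 => k _ _; rewrite lee_fin; exact: box_volume_ge0.
split=> [A0 e e0|cov].
  have infS : ereal_inf S \is a fin_num by rewrite A0.
  have [_ [a [b [ab sub ->]]]] := lb_ereal_inf_adherent e0 infS.
  rewrite A0 add0e => /ltW le; exists (fun k => (a k, b k)); by split.
apply/eqP; rewrite eq_le S0 andbT; apply/lee_addgt0Pr => e e0; rewrite add0e.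
have [ab [le sub vol]] := cov e e0; apply: le_trans vol.
apply: ereal_inf_lbound; exists (fun k => (ab k).1), (fun k => (ab k).2).
by split.
Qed.

Lemma lebesgue_null_sub (R : realType) (d : nat) (A B : set 'rV[R]_d) :
  A `<=` B -> lebesgue_null B -> lebesgue_null A.
Proof.
move=> AB /lebesgue_nullP nB; apply/lebesgue_nullP => e /nB[ab [le sub vol]].
by exists ab; split=> // x /AB /sub.
Qed.

(** The cover of the n-th set is given volume at most e / 2^(n+1), and a bijection from [nat] to
    [nat * nat] merges all the covers into one sequence. *)
Lemma lebesgue_null_bigcup (R : realType) (d : nat) (A : nat -> set 'rV[R]_d) :
  (forall n, lebesgue_null (A n)) -> lebesgue_null (\bigcup_n A n).
Proof.
move=> nA; apply/lebesgue_nullP => e e0.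
have covn n : exists ab, box_cover (A n) (e / (2 ^ n.+1)%:R) ab.
  have /lebesgue_nullP := nA n; apply; rewrite divr_gt0// ltr0n expn_gt0//.
have [ab abP] := choice covn.
have /card_esym/pcard_eqP[h] := card_nat2.
have hbij : set_bij [set: nat] [set: nat * nat] h by exact: bij.
exists (fun k => ab (h k).1 (h k).2); split=> [k i|x [n _ Anx]|].
- by have [] := abP (h k).1.
- have [_ /(_ x Anx)[m _ xm] _] := abP n.
  have [_ _ /(_ (n, m) I)[k _ hk]] := hbij.
  by exists k => //; rewrite hk.
- pose v n m := (box_volume (ab n m).1 (ab n m).2)%:E.
  have v0 n m : (0 <= v n m)%E.
    by rewrite lee_fin; apply: box_volume_ge0; have [] := abP n.
  rewrite (@nneseries_esumT _ (fun k => v (h k).1 (h k).2))//.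
  rewrite -(@reindex_esum _ _ _ _ [set: nat * nat] h (fun p => v p.1 p.2))//.
  rewrite -setXTT -(@esum_esum _ _ _ [set: nat] (fun=> [set: nat]) v)//.
  have -> : (\esum_(i in [set: nat]) \esum_(j in [set: nat]) v i j =
             \sum_(0 <= i <oo) \sum_(0 <= j <oo) v i j)%E.
    rewrite nneseries_esumT => [|n]; last by apply: nneseries_ge0 => ? _ _.
    by apply: eq_esum => n _; rewrite nneseries_esumT.
  apply: le_trans (epsilon_trick0 xpredT (ltW e0)).
  apply: lee_nneseries => [n _ _|n _].
    by apply: nneseries_ge0 => ? _ _; exact: v0.
  by have [] := abP n.
Qed.

(* In dimension 0 every box has volume 1, so that not even the empty set is
   null. *)
Lemma lebesgue_null_bigcup_count (R : realType) (d : nat) (I : countType)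
    (A : I -> set 'rV[R]_d) :
  lebesgue_null (set0 : set 'rV[R]_d) ->
  (forall i, lebesgue_null (A i)) -> lebesgue_null (\bigcup_i A i).
Proof.
move=> n0 nA; apply: (@lebesgue_null_sub _ _ _
  (\bigcup_n if unpickle n is Some i then A i else set0)).
  by move=> x [i _ Aix]; exists (pickle i) => //; rewrite pickleK.
by apply: lebesgue_null_bigcup => n; case: unpickle.
Qed.

(** * Null sets from finite covers and co-Lipschitz projections *)

Lemma lebesgue_null_fin_cover (R : realType) (m : nat)
    (A : set 'rV[R]_m.+1) :
  (forall e : R, 0 < e -> exists (I : finType) (a b : I -> 'rV[R]_m.+1),
     [/\ forall k i, a k ord0 i <= b k ord0 i,
         A `<=` \bigcup_k closed_box (a k) (b k) &
         \sum_k box_volume (a k) (b k) <= e]) ->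
  lebesgue_null A.
Proof.
move=> cov; apply/lebesgue_nullP => e /cov[I [a [b [ab sub vol]]]].
(* Past the index [#|I|] the sequence is padded with the one-point box at 0, whose volume vanishes
   because the dimension is positive. *)
pose c k := if insub k is Some o
  then (a (enum_val (o : 'I_#|I|)), b (enum_val o)) else (0, 0).
have c_le k i : (c k).1 ord0 i <= (c k).2 ord0 i.
  by rewrite /c; case: insub => [l|] /=.
exists c; split=> // [x /sub[k _ xk]|].
  by exists (enum_rank k) => //; rewrite /c valK/= enum_rankK.
rewrite (nneseries_split 0 #|I|); last first.
  by move=> k _; rewrite lee_fin; exact: box_volume_ge0.
rewrite eseries0; last first; first (move=> k kI _).
  rewrite /c insubF/=; last by rewrite ltnNge kI.
  by rewrite /box_volume big_ord_recl mxE subrr mul0r.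
rewrite adde0 sumEFin lee_fin; apply: le_trans vol.
rewrite add0n big_mkord (reindex (@enum_val I xpredT))/=; last first.
  by apply: onW_bij; exact: enum_val_bij.
rewrite le_eqVlt; apply/orP; left; apply/eqP; apply: eq_bigr => o _.
by rewrite /c valK.
Qed.

(* Cut the range of [p] into [n ^ m] cells of side [2M/n]: by hypothesis each
   preimage lies in a cube of side O(1/n) in dimension [m.+1]. *)
Lemma lebesgue_null_colipschitz (R : realType) (m : nat)
    (A : set 'rV[R]_m.+1) (p : 'rV[R]_m.+1 -> 'I_m -> R) (M C : R) :
  0 < M -> 0 <= C ->
  (forall x, A x -> forall j, `|p x j| < M) ->
  (forall x y, A x -> A y -> forall e : R, 0 <= e ->
     (forall j, `|p x j - p y j| <= e) ->
      forall i, `|x ord0 i - y ord0 i| <= C * e) ->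
  lebesgue_null A.
Proof.
move=> M0 C0 pM pC; apply: lebesgue_null_fin_cover => e e0.
(* With n+1 subdivisions, each of the (n+1)^m cells costs a cube of side 4CM/(n+1) in dimension m+1;
   the total volume is [K] / (n+1). *)
pose K := (4 * C * M) ^+ m.+1.
have [n Kn] : exists n : nat, K / e < n.+1%:R.
  by exists (Num.truncn (K / e)); exact: truncnS_gt.
have n0 : 0 < n.+1%:R :> R by rewrite ltr0n.
pose s x j := n.+1%:R * ((p x j + M) / (2 * M)).
have sP x j : A x -> 0 <= s x j < n.+1%:R.
  move=> Ax; have := pM x Ax j; rewrite ltr_norml => /andP[l u].
  apply/andP; split; first by rewrite mulr_ge0// ?divr_ge0//; lra.
  by rewrite /s gtr_pMr// ltr_pdivrMr; lra.
pose cell x : {ffun 'I_m -> 'I_n.+1} := [ffun j => inord (Num.truncn (s x j))].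
have cellP x y j : A x -> A y -> cell x = cell y ->
    `|p x j - p y j| <= 2 * M / n.+1%:R.
  move=> Ax Ay /ffunP/(_ j); rewrite !ffunE => /(congr1 val)/=.
  have /andP[sx0 sxn] := sP x j Ax; have /andP[sy0 syn] := sP y j Ay.
  rewrite !inordK ?truncn_lt_nat// => sxy.
  have /andP[lx ux] := truncn_itv sx0; have /andP[ly uy] := truncn_itv sy0.
  rewrite sxy in lx ux.
  (* The rescaled coordinates have the same integer part, so they differ by at most 1. *)
  have -> : p x j - p y j = 2 * M / n.+1%:R * (s x j - s y j).
    by rewrite /s; field; rewrite gt_eqF//= gt_eqF//.
  have c0 : 0 < 2 * M / n.+1%:R by rewrite divr_gt0// mulr_gt0.
  rewrite normrM gtr0_norm// ger_pMr//.
  move: lx ux ly uy; rewrite -[in _.+1]addn1 natrD => lx ux ly uy.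
  by rewrite ler_norml; lra.
(* One point of [A] in each occupied cell serves as the centre of a cube. Empty cells get the centre
   0, and their cubes are counted in the volume too. *)
pose rep (c : {ffun 'I_m -> 'I_n.+1}) : 'rV[R]_m.+1 :=
  if pselect (exists x, A x /\ cell x = c) is left h then projT1 (cid h) else 0.
have repP x : A x -> A (rep (cell x)) /\ cell (rep (cell x)) = cell x.
  move=> Ax; rewrite /rep; case: pselect => [h|]; first by case: (cid h).
  by case; exists x.
pose D := C * (2 * M / n.+1%:R).
have D0 : 0 <= D by rewrite mulr_ge0// divr_ge0// mulr_ge0// ltW.
exists {ffun 'I_m -> 'I_n.+1}, (fun c => rep c - const_mx D),
  (fun c => rep c + const_mx D); split=> [c i|x Ax|].
- by rewrite !mxE; lra.
- exists (cell x) => // i; rewrite !mxE.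
  have [Ar rx] := repP x Ax.
  have c0 : 0 <= 2 * M / n.+1%:R by rewrite divr_ge0// mulr_ge0// ltW.
  have := pC _ _ Ar Ax _ c0 (fun j => cellP _ _ j Ar Ax rx) i.
  by rewrite -/D ler_norml => /andP[]; lra.
- have vol c : box_volume (rep c - const_mx D) (rep c + const_mx D) =
      (2 * D) ^+ m.+1.
    rewrite /box_volume (eq_bigr (fun=> 2 * D)); last first.
      by move=> i _; rewrite !mxE; ring.
    by rewrite prodr_const card_ord.
  rewrite (eq_bigr _ (fun c _ => vol c)) sumr_const card_ffun !card_ord.
  have -> : (2 * D) ^+ m.+1 *+ n.+1 ^ m = K / n.+1%:R.
    rewrite -mulr_natr natrX.
    have -> : 2 * D = 4 * C * M / n.+1%:R by rewrite /D; field; rewrite gt_eqF.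
    rewrite exprMn -/K -mulrA; congr (_ * _).
    by rewrite exprVn exprS invfM -mulrA mulVf ?mulr1// expf_neq0// gt_eqF.
  by rewrite ler_pdivrMr// mulrC -ler_pdivrMr// ltW.
Qed.

Lemma lebesgue_null_set0 (R : realType) (m : nat) :
  lebesgue_null (set0 : set 'rV[R]_m.+1).
Proof.
by apply: (@lebesgue_null_colipschitz R m set0 (fun=> fun=> 0) 1 0).
Qed.

(** * Nullity of hyperplane pieces and of boundaries of convex sets *)

Lemma lebesgue_null_hyperplane (R : realType) (m : nat) (v : 'rV[R]_m.+1)
    (c M : R) :
  v != 0 -> 0 < M ->
  lebesgue_null
    [set x : 'rV[R]_m.+1 | (forall i, `|x ord0 i| < M) /\ dotv v x = c].
Proof.
move=> v0 M0; have [i0 vi0] : exists i0, v ord0 i0 != 0.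
  by apply/existsP; apply: contraNT v0; rewrite negb_exists => /forallP h;
    apply/eqP/rowP => i; rewrite mxE; exact/eqP/negPn/h.
(* On the hyperplane, coordinate [i0] is a function of the other ones; [S] is its Lipschitz constant
   for the sup norm. *)
pose S := \sum_(j < m) `|v ord0 (lift i0 j)| / `|v ord0 i0|.
have S0 : 0 <= S by apply: sumr_ge0 => j _; rewrite divr_ge0.
apply: (@lebesgue_null_colipschitz R m _ (fun x j => x ord0 (lift i0 j)) M
  (1 + S)) => //; first by rewrite addr_ge0.
  by move=> x [xM _] j; exact: xM.
move=> x y [_ xc] [_ yc] e e0 xye i.
have [j ->|->] := unliftP i0 i.
  by apply: le_trans (xye j) _; rewrite mulrDl mul1r lerDl mulr_ge0.
have /eqP : dotv v x - dotv v y = 0 by rewrite xc yc subrr.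
rewrite /dotv (bigD1_ord i0)//= [in X in _ - X](bigD1_ord i0)//= opprD addrACA.
rewrite -mulrBr -sumrB addr_eq0 => /eqP/(congr1 (fun z => `|z|)).
rewrite normrM normrN => vE.
rewrite -(ler_pM2l (_ : 0 < `|v ord0 i0|)) ?normr_gt0// vE.
apply: le_trans (ler_norm_sum _ _ _) _.
apply: (@le_trans _ _ (`|v ord0 i0| * (S * e))); last first.
  by rewrite ler_wpM2l// ler_wpM2r// lerDr.
rewrite mulrA /S mulr_sumr mulr_suml; apply: ler_sum => j _.
rewrite -mulrBr normrM [`|v ord0 i0| * _]mulrC divfK ?normr_eq0//.
by rewrite ler_wpM2l.
Qed.

(** Replace [x] by a point u of [U] so close to it that the strict inequalities persist. Then y = l
    u + (1 - l) b with b in the cube of half-side [r], and convexity applies. *)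
Lemma convex_closure_segment (R : realType) (d : nat) (U : set 'rV[R]_d)
    (r l : R) (x y : 'rV[R]_d) :
  convex_set U -> (forall b : 'rV[R]_d, (forall i, `|b ord0 i| < r) -> U b) ->
  closure U x -> 0 <= l < 1 ->
  (forall i, `|y ord0 i - l * x ord0 i| < (1 - l) * r) -> U y.
Proof.
move=> Uc Ur Ux /andP[l0 l1] yx.
have near_x i : \forall u \near x,
    `|y ord0 i - l * (u : 'rV[R]_d) ord0 i| < (1 - l) * r.
  have cu : (u : 'rV[R]_d) ord0 i @[u --> x] --> x ord0 i.
    exact: coord_continuous.
  have cx : `|y ord0 i - l * (u : 'rV[R]_d) ord0 i| @[u --> x] -->
      `|y ord0 i - l * x ord0 i|.
    exact: (cvg_norm (cvgB (cvg_cst (y ord0 i)) (cvgM (cvg_cst l) cu))).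
  exact: (cvgr_lt _ cx _ (yx i)).
have [u [Uu yu]] := Ux _ (filter_forall _ near_x); have l'0 : 0 < 1 - l.
  by rewrite subr_gt0.
pose b := (1 - l)^-1 *: (y - l *: u).
have Ub : U b.
  apply: Ur => i; rewrite !mxE normrM gtr0_norm ?invr_gt0//.
  by rewrite mulrC ltr_pdivrMr// [ltRHS]mulrC; exact: yu.
have := Uc u b (Itv01 l0 (ltW l1)) (mem_set Uu) (mem_set Ub).
move/set_mem; congr U; rewrite /conv/= /b /unstable.onem scalerA.
by rewrite divff ?gt_eqF// scale1r addrC subrK.
Qed.

(* Radial projection to a face of the unit cube is co-Lipschitz on the part of
   the boundary where a given coordinate dominates with a given sign. *)
Lemma lebesgue_null_convex_boundary (R : realType) (m : nat)
    (U : set 'rV[R]_m.+1) (M : R) :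
  0 < M -> open U -> convex_set U -> U 0 ->
  lebesgue_null
    [set x : 'rV[R]_m.+1 | [/\ closure U x, ~ U x & forall i, `|x ord0 i| < M]].
Proof.
move=> M0 Uo Uc U0; set B := [set _ | _].
have [r r0 Ur] : exists2 r : R, 0 < r &
    forall b : 'rV[R]_m.+1, (forall i, `|b ord0 i| < r) -> U b.
  have /nbhs_ballP[r r0 rU] : nbhs (0 : 'rV[R]_m.+1) U.
    exact: open_nbhs_nbhs.
  exists r => // b br; apply: rU; split=> // i j.
  by rewrite /ball/= mxE sub0r normrN (ord1 i).
pose A (q : 'I_m.+1 * bool) := B `&` [set x : 'rV[R]_m.+1 |
  forall j, `|x ord0 j| <= (-1) ^+ q.2 * x ord0 q.1].
apply: (@lebesgue_null_sub _ _ _ (\bigcup_q A q)).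
  move=> x Bx.
  pose i := [arg max_(i > ord0 | true) `|x ord0 i|]%O.
  have xi j : `|x ord0 j| <= `|x ord0 i|.
    by rewrite /i; case: arg_maxP => // k _; exact.
  (* The boolean is the sign bit: (-1) to its power times the coordinate is the absolute value. *)
  exists (i, x ord0 i < 0) => //; split=> // j /=.
  by apply: le_trans (xi j) _; rewrite -normrEsign.
apply: lebesgue_null_bigcup_count => [|[i0 s]]; first exact: lebesgue_null_set0.
have AP x : A (i0, s) x -> 0 < `|x ord0 i0| /\
    [/\ x ord0 i0 = (-1) ^+ s * `|x ord0 i0|,
        forall j, `|x ord0 j| <= `|x ord0 i0| & `|x ord0 i0| < M].
  move=> [[_ Ux xM] /= xi]; have sx : (-1) ^+ s * x ord0 i0 = `|x ord0 i0|.
    apply/eqP; rewrite eq_le xi andbT; apply: le_trans (ler_norm _) _.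
    by rewrite normrM normr_sign mul1r.
  rewrite sx in xi; split; last by split; rewrite // -sx signrMK.
  rewrite lt_neqAle normr_ge0 andbT; apply: contra_notN Ux => /eqP x0.
  apply: Ur => j; apply: le_lt_trans (xi j) _; by rewrite -x0.
pose w (x : 'rV[R]_m.+1) j := x ord0 j / `|x ord0 i0|.
have wE x j : A (i0, s) x -> x ord0 j = `|x ord0 i0| * w x j.
  by move=> /AP[x0 _]; rewrite /w mulrC divfK// gt_eqF.
have w1 x j : A (i0, s) x -> `|w x j| <= 1.
  move=> /AP[x0 [_ xi _]].
  by rewrite /w normrM normfV normr_id ler_pdivrMr// mul1r.
(* With t and u the absolute values of coordinate [i0] of x and y, x - y = (t - u) w(x) + u (w(x) -
   w(y)). The first term is at most (M^2 / r) e by [radius] below, the second at most M e. The bound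
   2 turns |w| <= 1 into a strict inequality. *)
apply: (@lebesgue_null_colipschitz R m _ (fun x j => w x (lift i0 j)) 2
  (M * M / r + M)) => //.
- by rewrite addr_ge0 ?divr_ge0 ?mulr_ge0// ltW.
- by move=> x Ax j; apply: le_lt_trans (w1 _ _ Ax) _; lra.
move=> x y Ax Ay e e0 wxy.
(* The forgotten coordinate [i0] of [w] equals (-1)^s at both points, so the bound extends to it. *)
have wi x' y' : A (i0, s) x' -> A (i0, s) y' ->
    (forall j, `|w x' (lift i0 j) - w y' (lift i0 j)| <= e) ->
    forall i, `|w x' i - w y' i| <= e.
  move=> Ax' Ay' wxy' i; have [j ->//|->] := unliftP i0 i.
  have [x0 [xs _ _]] := AP _ Ax'; have [y0 [ys _ _]] := AP _ Ay'.
  rewrite /w xs ys !normrM !normr_sign !normr_id !mul1r -!mulrA.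
  by rewrite !divff ?gt_eqF// subrr normr0.
have {wi wxy} wxy := wi _ _ Ax Ay wxy.
(* For [t >= u], the point [y] is at distance at most [u e] from [(u / t) x],
   around which [U] contains a cube of half-side [(1 - u / t) r]. *)
have radius x' y' : A (i0, s) x' -> A (i0, s) y' ->
    (forall i, `|w x' i - w y' i| <= e) ->
    `|x' ord0 i0| - `|y' ord0 i0| <= M * M / r * e.
  move=> Ax' Ay' wxy'; have [x0 [_ _ xM]] := AP _ Ax'.
  have [y0 [_ _ yM]] := AP _ Ay'; have [[Ux _ _] _] := Ax'.
  have [[_ Uy _] _] := Ay'.
  have C0 : 0 <= M * M / r by rewrite divr_ge0 ?mulr_ge0// ltW.
  have [xy|yx] := leP `|x' ord0 i0| `|y' ord0 i0|.
    by apply: (@le_trans _ _ 0); [rewrite subr_le0|rewrite mulr_ge0].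
  rewrite leNgt; apply: contra_notN Uy => far.
  have l01 : 0 <= `|y' ord0 i0| / `|x' ord0 i0| < 1.
    by rewrite divr_ge0//= ltr_pdivrMr// mul1r.
  apply: (convex_closure_segment Uc Ur Ux l01) => i.
  rewrite (wE _ i Ax') (wE _ i Ay') [_ / _ * _]mulrA divfK ?gt_eqF//.
  rewrite -mulrBr normrM normr_id distrC.
  apply: (@le_lt_trans _ _ (`|y' ord0 i0| * e)).
    by rewrite ler_wpM2l.
  rewrite -(ltr_pM2l x0) [ltRHS](_ : _ =
    (`|x' ord0 i0| - `|y' ord0 i0|) * r); last by field; rewrite gt_eqF.
  rewrite -ltr_pdivrMr//; apply: le_lt_trans far.
  rewrite mulrA mulrAC ler_wpM2r// ler_wpM2r ?invr_ge0 ?ltW//.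
  by apply: ltr_pM.
have rxy := radius _ _ Ax Ay wxy.
have ryx : `|y ord0 i0| - `|x ord0 i0| <= M * M / r * e.
  by apply: radius => // j; rewrite distrC.
move=> i; rewrite (wE _ i Ax) (wE _ i Ay).
have -> : `|x ord0 i0| * w x i - `|y ord0 i0| * w y i =
  (`|x ord0 i0| - `|y ord0 i0|) * w x i + `|y ord0 i0| * (w x i - w y i).
  by ring.
apply: le_trans (ler_normD _ _) _; rewrite [leRHS]mulrDl !normrM normr_id.
apply: lerD; last by apply: ler_pM => //; have [_ [_ _ /ltW]] := AP _ Ay.
rewrite -[leRHS]mulr1; apply: ler_pM => //; last by rewrite -normrM; exact: w1.
by rewrite ler_norml; lra.
Qed.

(** * Inner product, Euclidean norm and distance to a set *)

Lemma dotv_is_linear (R : realType) (d : nat) (v : 'rV[R]_d) :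
  linear_for *%R (dotv v).
Proof.
move=> a x y; rewrite /dotv mulr_sumr -big_split; apply: eq_bigr => i _.
by rewrite !mxE mulrDr mulrCA.
Qed.

(** Besides enabling [linearB] and [linearZ], this lets [dotv v] serve as the linear part required
    by [locally_affine_at]. *)
HB.instance Definition _ (R : realType) (d : nat) (v : 'rV[R]_d) :=
  GRing.isLinear.Build R 'rV[R]_d R *%R (dotv v) (dotv_is_linear v).

Lemma dotvC (R : realType) (d : nat) (u v : 'rV[R]_d) : dotv u v = dotv v u.
Proof. by apply: eq_bigr => i _; rewrite mulrC. Qed.

Lemma dotvZl (R : realType) (d : nat) (a : R) (u v : 'rV[R]_d) :
  dotv (a *: u) v = a * dotv u v.
Proof. by rewrite dotvC linearZ/= dotvC. Qed.

Lemma dotvBl (R : realType) (d : nat) (u v y : 'rV[R]_d) :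
  dotv (u - v) y = dotv u y - dotv v y.
Proof. by rewrite dotvC linearB/= !(dotvC y). Qed.

Lemma dotv_continuous (R : realType) (d : nat) (v : 'rV[R]_d) :
  continuous (dotv v).
Proof.
apply: continuous_big => [|i _ x]; first exact: add_continuous.
have cx : (y : 'rV[R]_d) ord0 i @[y --> x] --> x ord0 i.
  exact: coord_continuous.
exact: (cvgM (cvg_cst (v ord0 i)) cx).
Qed.

Lemma enorm_coord (R : realType) (d : nat) (x : 'rV[R]_d) i :
  `|x ord0 i| <= enorm x.
Proof.
rewrite -sqrtr_sqr; apply: ler_wsqrtr; rewrite /dotv (bigD1 i)//= expr2 lerDl.
by apply: sumr_ge0 => j _; rewrite -expr2 sqr_ge0.
Qed.

Lemma dist_set_le (R : realType) (d : nat) (U : set 'rV[R]_d) u y :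
  U u -> dist_set U y <= enorm (y - u).
Proof.
move=> Uu; apply: ge_inf; last by exists u.
by exists 0 => _ [v _ <-]; exact: sqrtr_ge0.
Qed.

(** Points of [U] approach the infimum, and [enorm_coord] turns Euclidean closeness into membership
    in a sup-norm ball. *)
Lemma dist_set_closure (R : realType) (d : nat) (U : set 'rV[R]_d) y :
  U !=set0 -> dist_set U y <= 0 -> closure U y.
Proof.
move=> [u0 Uu0] d0 B /nbhs_ballP[e /= e0 eB].
have [|_ [u Uu <-] ue] := @inf_adherent R [set enorm (y - u) | u in U] e e0.
  split; first by exists (enorm (y - u0)), u0.
  by exists 0 => _ [v _ <-]; exact: sqrtr_ge0.
exists u; split=> //; apply: eB; split=> // i j; rewrite (ord1 i) /ball/=.
have := enorm_coord (y - u) j; rewrite !mxE => /le_lt_trans; apply.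
by apply: lt_le_trans ue _; rewrite gerDr.
Qed.

(** * Bounds and convexity for the finite maxima [Phi_] *)

Section Phi.
Context (R : realType) (d : nat) (sigma x_ : nat -> 'rV[R]_d).

Lemma Phi_ge0 n y : 0 <= Phi_ sigma x_ n y.
Proof. exact: bigmax_ge_id. Qed.

Lemma le_Phi n i y : (1 <= i <= n)%N ->
  dotv (sigma i) (y - x_ i) <= Phi_ sigma x_ n y.
Proof.
move=> i1n; apply: (@le_bigmax_seq _ _ _ _ 0 i xpredT) => //.
by rewrite mem_index_iota ltnS.
Qed.

Lemma Phi_le n y t : 0 <= t ->
  (forall i, (1 <= i <= n)%N -> dotv (sigma i) (y - x_ i) <= t) ->
  Phi_ sigma x_ n y <= t.
Proof.
by move=> t0 yt; rewrite /Phi_ big_nat; apply: bigmax_le.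
Qed.

Lemma Phi_convex n (l : {i01 R}) (x y : convex_lmodType 'rV[R]_d) :
  Phi_ sigma x_ n (conv l x y) <=
  l%:num * Phi_ sigma x_ n x + (1 - l%:num) * Phi_ sigma x_ n y.
Proof.
have l0 : 0 <= l%:num by [].
have l1 : 0 <= 1 - l%:num by rewrite subr_ge0.
apply: Phi_le => [|i ni]; first by rewrite addr_ge0// mulr_ge0// Phi_ge0.
have -> : conv l x y - x_ i = l%:num *: ((x : 'rV_d) - x_ i) +
    (1 - l%:num) *: ((y : 'rV_d) - x_ i).
  by rewrite !scalerBr addrACA -opprD -scalerDl [l%:num + _]addrC subrK scale1r.
by rewrite linearD !linearZ lerD// ler_wpM2l// le_Phi.
Qed.

End Phi.

(** * Decay of the coefficients, and finite maxima of affine functions *)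

Lemma fast_decreasing_small (R : realType) (a : nat -> R) (e : R) :
  (forall k, (1 <= k)%N -> 0 < a k) ->
  (forall k, (1 <= k)%N -> a k.+1 <= a k) ->
  (forall k, (1 <= k)%N -> a k.+1 <= k%:R^-1 * a k) ->
  0 < e -> exists K, forall k, (K < k)%N -> a k < e.
Proof.
move=> a0 a_decr a_fast e0.
have a1 k : a k.+1 <= a 1%N.
  by elim: k => // k IHk; apply: le_trans IHk; exact: a_decr.
(* Monotonicity turns the recursion into a_(k+1) <= a_1 / k, which is below [e] as soon as k > a_1 /
   e. *)
exists (Num.truncn (a 1%N / e)).+1 => -[//|[//|k]]; rewrite !ltnS => Kk.
apply: le_lt_trans (a_fast _ _) _ => //.
rewrite mulrC ltr_pdivrMr ?ltr0n// mulrC -ltr_pdivrMr//.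
apply: (@le_lt_trans _ _ (a 1%N / e)); first by rewrite ler_pM2r ?invr_gt0.
apply: lt_le_trans (truncnS_gt _) _; by rewrite ler_nat.
Qed.

(** Take q maximal at [y]. A member strictly smaller at [y] stays smaller nearby by continuity; a
    member tied with q has the same slope, hence the same constant, and is the same function. *)
Lemma near_max_affine (R : realType) (d : nat) (I : finType) (P : pred I)
    (v : I -> 'rV[R]_d) (c : I -> R) (y : 'rV[R]_d) (p0 : I) :
  P p0 ->
  (forall p q, dotv (v p) y - c p = dotv (v q) y - c q -> v p = v q) ->
  exists2 q, P q & \forall z \near y,
    forall p, P p -> dotv (v p) z - c p <= dotv (v q) z - c q.
Proof.
move=> Pp0 vinj.
case: (arg_maxP (fun p => dotv (v p) y - c p) Pp0) => q Pq qmax.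
exists q => //.
have near_p p : \forall z \near y,
    P p -> dotv (v p) z - c p <= dotv (v q) z - c q.
  have [Pp|nPp] := boolP (P p); last first.
    by apply: (filterE (nbhs_filter y)) => z.
  have := qmax p Pp; rewrite /= le_eqVlt => /orP[/eqP pq|pq].
    have vpq := vinj _ _ pq; have cpq : c p = c q.
      by move: pq; rewrite vpq => /addrI/oppr_inj.
    by apply: (filterE (nbhs_filter y)) => z _; rewrite vpq cpq.
  pose D := (dotv (v q) y - c q) - (dotv (v p) y - c p).
  have cD : (dotv (v q) z - c q) - (dotv (v p) z - c p) @[z --> y] --> D.
    exact: (cvgB (cvgB (@dotv_continuous _ _ (v q) y) (cvg_cst (c q)))
                 (cvgB (@dotv_continuous _ _ (v p) y) (cvg_cst (c p)))).
  have D0 : 0 < D by rewrite subr_gt0.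
  have cmp z : 0 < (dotv (v q) z - c q) - (dotv (v p) z - c p) ->
      true -> dotv (v p) z - c p <= dotv (v q) z - c q.
    by rewrite subr_gt0 => /ltW.
  exact: (filterS cmp (cvgr_gt _ cD _ D0)).
exact: (filter_forall _ near_p).
Qed.

(** * Sign, convexity, affine pieces and zero set of [varphi] *)

Unset Implicit Arguments.

Theorem proposition9p2 (R : realType) (d : nat)
    (Omega U : set 'rV[R]_d)
    (sigma x_ : nat -> 'rV[R]_d) (N : nat -> nat) (a : nat -> R)
    (Omega_bounded : bounded_set Omega)
    (Omega_open : open Omega)
    (Omega_convex : convex_set Omega)
    (Omega_ball : Omega `<=` [set y | enorm y < 1])
    (U_open : open U)
    (U_convex : convex_set U)
    (U_Omega : U `<=` Omega)
    (U_0 : U 0)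
    (sigma_unit : forall i, (1 <= i)%N -> enorm (sigma i) = 1)
    (sigma_dense : [set v | enorm v = 1] `<=`
                   closure [set sigma i | i in [set i | (1 <= i)%N]])
    (x_boundary : forall i, (1 <= i)%N -> boundary U (x_ i))
    (x_max : forall i, (1 <= i)%N -> forall y, closure U y ->
             dotv (sigma i) y <= dotv (sigma i) (x_ i))
    (N_ge1 : forall k, (1 <= k)%N -> (1 <= N k)%N)
    (N_approx : forall k, (1 <= k)%N -> forall n, (N k <= n)%N ->
      (ereal_sup [set `|Phi_ sigma x_ n y - dist_set U y|%:E | y in Omega]
         < (k%:R^-1)%:E)%E)
    (a_pos : forall k, (1 <= k)%N -> 0 < a k)
    (a_decr : forall k, (1 <= k)%N -> a k.+1 <= a k)
    (a_fast : forall k, (1 <= k)%N -> a k.+1 <= k%:R^-1 * a k) :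
  [/\ forall y, Omega y -> 0 <= varphi sigma x_ a N y,
      convex_function Omega (varphi sigma x_ a N),
      locally_affine_ae Omega (varphi sigma x_ a N) &
      forall y, Omega y -> (varphi sigma x_ a N y = 0 <-> closure U y)].
Proof.
(* In dimension 0 there is no unit vector, so the hypotheses are contradictory. *)
case: d => [|d] in Omega U sigma x_ Omega_bounded Omega_open Omega_convex
    Omega_ball U_open U_convex U_Omega U_0 sigma_unit sigma_dense x_boundary
    x_max N_approx *.
  have := sigma_unit 1%N isT; rewrite /enorm /dotv big_ord0 sqrtr0 => /eqP.
  by rewrite eq_sym oner_eq0.
set phi := varphi _ _ _ _; pose Phi := Phi_ sigma x_.
have Omega_coord y i : Omega y -> `|y ord0 i| < 1.
  by move=> /Omega_ball; apply: le_lt_trans; exact: enorm_coord.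
have approx k y : (1 <= k)%N -> Omega y ->
    `|Phi (N k) y - dist_set U y| < k%:R^-1.
  move=> k1 Oy; rewrite -lte_fin.
  apply: le_lt_trans (N_approx k k1 _ (leqnn _)).
  by apply: ereal_sup_ubound; exists y.
(* Since 0 lies in [U], the distance is at most |y| < 1, and the approximation error is below 1/k <=
   1. *)
have Phi2 k y : (1 <= k)%N -> Omega y -> Phi (N k) y <= 2.
  move=> k1 Oy; have := approx k y k1 Oy; rewrite ltr_norml => /andP[_].
  have := dist_set_le y U_0; rewrite subr0.
  have := Omega_ball y Oy; rewrite /= => y1 dy Phiy.
  have : k%:R^-1 <= 1 :> R by rewrite invf_le1 ?ltr0n// ler1n.
  lra.
have a_le1 k : (1 <= k)%N -> a k <= a 1%N.
  case: k => // k _; elim: k => // k IHk; apply: le_trans IHk; exact: a_decr.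
have phi_ge k y : (1 <= k)%N -> Omega y -> a k * Phi (N k) y <= phi y.
  move=> k1 Oy; apply: ub_le_sup; last by exists k.
  exists (a 1%N * 2) => _ [j j1 <-].
  by apply: ler_pM; rewrite ?Phi_ge0 ?Phi2 ?a_le1// ltW// a_pos.
have phi_le y t : (forall k, (1 <= k)%N -> a k * Phi (N k) y <= t) ->
    phi y <= t.
  move=> yt; apply: ge_sup; first by exists (a 1%N * Phi (N 1%N) y), 1%N.
  by move=> _ [k k1 <-]; exact: yt.
have phi_ge0 y : Omega y -> 0 <= phi y.
  move=> Oy; apply: le_trans (phi_ge 1%N y isT Oy).
  by rewrite mulr_ge0 ?Phi_ge0// ltW// a_pos.
have phi_closure y : Omega y -> closure U y -> phi y = 0.
  move=> Oy Uy; apply/eqP; rewrite eq_le phi_ge0// andbT; apply: phi_le => k k1.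
  rewrite pmulr_rle0 ?a_pos//; apply: Phi_le => // i /andP[i1 _].
  by rewrite linearB subr_le0; exact: x_max.
have phi_gt0 y : Omega y -> ~ closure U y ->
    exists2 k, (1 <= k)%N & 0 < Phi (N k) y.
  move=> Oy nUy; apply: contrapT => nk; apply: nUy.
  apply: dist_set_closure; first by exists 0.
  rewrite leNgt; apply/negP => d0.
  (* This gives 1/k < dist(y, U), so an approximation within 1/k is still positive at y. *)
  pose k := (Num.truncn (dist_set U y)^-1).+1.
  have kd : k%:R^-1 < dist_set U y.
    by rewrite invf_plt ?posrE ?ltr0n//; exact: truncnS_gt.
  apply: nk; exists k => //.
  have := approx k y isT Oy; rewrite ltr_norml => /andP[+ _].
  lra.
split=> //.
- move=> l x y /set_mem Ox /set_mem Oy.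
  have l0 : 0 <= l%:num by [].
  have l1 : 0 <= 1 - l%:num by rewrite subr_ge0.
  apply: phi_le => k k1; rewrite convRE.
  apply: (@le_trans _ _ (a k *
    (l%:num * Phi (N k) x + (1 - l%:num) * Phi (N k) y))).
    by rewrite ler_pM2l ?a_pos//; exact: Phi_convex.
  rewrite mulrDr 2!(mulrCA (a k)).
  by apply: lerD; apply: ler_wpM2l => //; exact: phi_ge.
(* The pair p = (k, i) indexes the affine piece a_k sigma_i.(y - x_i), of slope [v p] and constant
   [- c p]. *)
- pose v p := a p.1 *: sigma p.2; pose c p := dotv (v p) (x_ p.2).
  have vcE p y : dotv (v p) y - c p = a p.1 * dotv (sigma p.2) (y - x_ p.2).
    by rewrite -dotvZl linearB.
  (* [None] indexes the boundary of [U], [Some (p, q)] the set where pieces p and q cross. Pieces of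
     equal slope never cross: they agree everywhere or nowhere. The cube |x_i| < 1 contains [Omega]
     and keeps every set bounded. *)
  pose H (q : option ((nat * nat) * (nat * nat))) : set 'rV[R]_d.+1 :=
    match q with
    | None => [set x : 'rV[R]_d.+1 |
        [/\ closure U x, ~ U x & forall i, `|x ord0 i| < 1]]
    | Some (p, q) => if v p == v q then set0 else
        [set x : 'rV[R]_d.+1 | (forall i, `|x ord0 i| < 1) /\
          dotv (v p - v q) x = c p - c q]
    end.
  apply: (@lebesgue_null_sub _ _ _ (\bigcup_q H q)); last first.
    apply: lebesgue_null_bigcup_count => [|[[p q]|]].
    - exact: lebesgue_null_set0.
    - rewrite /H; case: eqP => [_|/eqP vpq]; first exact: lebesgue_null_set0.
      by apply: lebesgue_null_hyperplane; rewrite ?subr_eq0.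
    - exact: lebesgue_null_convex_boundary.
  move=> y [Oy]; apply: contra_notP => nH.
  have [Uy|nUy] := pselect (closure U y).
    have Uy0 : U y.
      apply: contrapT => nUy; apply: nH; exists None => //.
      by split=> // i; exact: Omega_coord.
    exists (dotv 0), 0; have phi0 z : U z -> Omega z -> phi z = dotv 0 z + 0.
      move=> Uz Oz; rewrite addr0 dotvC linear0.
      by apply: phi_closure => //; exact: subset_closure.
    exact: (filterS phi0 (open_nbhs_nbhs (conj U_open Uy0))).
  have vinj p q : dotv (v p) y - c p = dotv (v q) y - c q -> v p = v q.
    move=> pq; apply: contrapT => vpq; apply: nH; exists (Some (p, q)) => //.
    rewrite /H; case: eqP => // _; split=> [i|]; first exact: Omega_coord.
    by rewrite dotvBl; lra.
  have [k0 k01 Phi0] := phi_gt0 y Oy nUy.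
  have [i0 i0N L0] : exists2 i, (1 <= i <= N k0)%N &
      0 < dotv (v (k0, i)) y - c (k0, i).
    apply: contrapT => ni; move: Phi0; rewrite ltNge => /negP; apply.
    apply: Phi_le => // i iN; rewrite leNgt; apply/negP => i0; apply: ni.
    by exists i => //; rewrite vcE mulr_gt0// a_pos.
  (* Near y the piece (k0, i0) stays above [e], whereas a_k < e/2 and Phi <= 2 keep the k-th term
     below [e]. Only finitely many k can therefore matter. *)
  pose e := (dotv (v (k0, i0)) y - c (k0, i0)) / 2.
  have e0 : 0 < e by rewrite divr_gt0.
  have [K0 aK] := fast_decreasing_small a_pos a_decr a_fast
    (divr_gt0 e0 (ltr0n R 2)).
  (* Taking [K] at least k0 keeps the positive piece in the finite family. The ordinals include the
     index 0, which [P] discards. *)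
  pose K := maxn K0 k0; pose M := (\max_(k < K.+1) N k)%N.
  pose P (p : 'I_K.+1 * 'I_M.+1) := (1 <= p.1)%N && (1 <= p.2 <= N p.1)%N.
  pose w (p : 'I_K.+1 * 'I_M.+1) : nat * nat := (val p.1, val p.2).
  have wP k i : (1 <= k <= K)%N -> (1 <= i <= N k)%N ->
      exists2 p, P p & w p = (k, i).
    move=> /andP[k1 kK] iN; have kK' : (k < K.+1)%N by [].
    have iM : (i < M.+1)%N.
      have /andP[_ /leq_trans] := iN; rewrite ltnS; apply.
      exact: (leq_bigmax_cond (Ordinal kK')).
    by exists (Ordinal kK', Ordinal iM) => //; rewrite /P /= k1.
  have [|p0 Pp0 wp0] := wP k0 i0 _ i0N; first by rewrite k01 leq_maxr.
  have [q /andP[q1 qN] q_near] :=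
    near_max_affine Pp0 (fun p q => vinj (w p) (w q)).
  have e_near : \forall z \near y, e < dotv (v (k0, i0)) z - c (k0, i0).
    have cz : dotv (v (k0, i0)) z - c (k0, i0) @[z --> y] -->
        dotv (v (k0, i0)) y - c (k0, i0).
      exact: (cvgB (@dotv_continuous _ _ (v (k0, i0)) y)
                   (cvg_cst (c (k0, i0)))).
    by apply: (cvgr_gt _ cz); rewrite /e; lra.
  exists (dotv (v (w q))), (- c (w q)).
  have phiE z : (forall p, P p ->
        dotv (v (w p)) z - c (w p) <= dotv (v (w q)) z - c (w q)) ->
      e < dotv (v (k0, i0)) z - c (k0, i0) ->
      Omega z -> phi z = dotv (v (w q)) z + - c (w q); last first.
    exact: (filterS2 _ phiE q_near e_near).
  move=> q_max ez Oz.
  apply/eqP; rewrite eq_le; apply/andP; split; last first.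
    rewrite vcE; apply: le_trans (phi_ge (w q).1 z q1 Oz).
    by rewrite ler_pM2l ?a_pos//; exact: le_Phi.
  have qe : e <= dotv (v (w q)) z - c (w q).
    by apply: le_trans (q_max _ Pp0); rewrite wp0 ltW.
  apply: phi_le => k k1; have [kK|Kk] := leqP k K; last first.
    apply: le_trans qe; have ak := aK k (leq_ltn_trans (leq_maxl _ _) Kk).
    apply: (@le_trans _ _ (a k * 2)); last by lra.
    by rewrite ler_pM2l ?a_pos// Phi2.
  (* The maximum in [Phi_] also contains 0; it is dominated because piece q is at least e > 0 at
     z. *)
  rewrite mulrC -ler_pdivlMr ?a_pos//; apply: Phi_le => [|i iN].
    by rewrite divr_ge0// ?(le_trans (ltW e0) qe)// ltW// a_pos.
  rewrite ler_pdivlMr ?a_pos// mulrC.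
  have [|p Pp wp] := wP k i _ iN; first by rewrite k1.
  by have := q_max p Pp; rewrite wp vcE.
- move=> y Oy; split=> [phi0|]; last exact: phi_closure.
  apply: contrapT => /(phi_gt0 y Oy)[k k1 Phik].
  have := phi_ge k y k1 Oy; rewrite phi0 leNgt => /negP; apply.
  by rewrite mulr_gt0// a_pos.
Qed.
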